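(* Let $\tau^{(5)}_{\alpha\beta}(\mathbf s,\mathbf t,\bar{\mathbf t})$ and $\tau^{(6)}_{\alpha\beta}(\mathbf s,\mathbf t,\bar{\mathbf t})$ ($\alpha,\beta=1,\dots,N$, $\mathbf s\in\mathbb Z^N$) be related by the sign factor $$\tau^{(5)}_{\alpha\beta}(\mathbf s,\mathbf t,\bar{\mathbf t})=(-1)^{|\mathbf s|(|\mathbf s|-1)/2}\,\epsilon_{\alpha\beta}(\mathbf s)\,\tau^{(6)}_{\alpha\beta}(\mathbf s,\mathbf t,\bar{\mathbf t}),\qquad |\mathbf s|=\sum_{\mu=1}^Ns_\mu.$$ Then, under this substitution, the following two systems of bilinear equations (each for all $\alpha,\beta$ and all $\mathbf s,\mathbf s',\mathbf t,\mathbf t',\bar{\mathbf t},\bar{\mathbf t}'$) become identical: $$\text{(I)}\quad\sum_{\gamma=1}^N(-1)^{\delta_{\beta\gamma}}\oint_{C_\infty}z^{s_\gamma-s'_\gamma+\delta_{\alpha\gamma}+\delta_{\beta\gamma}-2}e^{\xi(\mathbf t_\gamma-\mathbf t'_\gamma,z)}\tau^{(5)}_{\alpha\gamma}(\mathbf s,\mathbf t-[z^{-1}]_\gamma,\bar{\mathbf t})\tau^{(5)}_{\gamma\beta}(\mathbf s',\mathbf t'+[z^{-1}]_\gamma,\bar{\mathbf t}')dz$$ $$=\sum_{\gamma=1}^N(-1)^{\delta_{\alpha\gamma}}\oint_{C_\infty}z^{s'_\gamma-s_\gamma-2}e^{\xi(\bar{\mathbf t}_\gamma-\bar{\mathbf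 t}'_\gamma,z)}\tau^{(5)}_{\alpha\gamma}(\mathbf s+[1]_\gamma,\mathbf t,\bar{\mathbf t}-[z^{-1}]_\gamma)\tau^{(5)}_{\gamma\beta}(\mathbf s'-[1]_\gamma,\mathbf t',\bar{\mathbf t}'+[z^{-1}]_\gamma)dz$$ and $$\text{(II)}\quad\sum_{\gamma=1}^N\epsilon_{\alpha\gamma}(\mathbf s)\epsilon^{-1}_{\beta\gamma}(\mathbf s')\oint_{C_\infty}z^{s_\gamma-s'_\gamma+\delta_{\alpha\gamma}+\delta_{\beta\gamma}-2}e^{\xi(\mathbf t_\gamma-\mathbf t'_\gamma,z)}\tau^{(6)}_{\alpha\gamma}(\mathbf s,\mathbf t-[z^{-1}]_\gamma,\bar{\mathbf t})\tau^{(6)}_{\gamma\beta}(\mathbf s',\mathbf t'+[z^{-1}]_\gamma,\bar{\mathbf t}')dz$$ $$=-\sum_{\gamma=1}^N\epsilon_{\alpha\gamma}\epsilon_{\beta\gamma}\,\epsilon_{\alpha\gamma}(\mathbf s)\epsilon_{0N}(\mathbf s)\epsilon^{-1}_{\beta\gamma}(\mathbf s')\epsilon^{-1}_{0N}(\mathbf s')\oint_{C_\infty}z^{s'_\gamma-s_\gamma-2}e^{\xi(\bar{\mathbf t}_\gamma-\bar{\mathbf t}'_\gamma,z)}\tau^{(6)}_{\alpha\gamma}(\mathbf s+[1]_\gamma,\mathbf t,\bar{\mathbf t}-[z^{-1}]_\gamma)\tau^{(6)}_{\gamma\beta}(\mathbf s'-[1]_\gamma,\mathbf t',\bar{\mathbf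 t}'+[z^{-1}]_\gamma)dz.$$ In particular, $\tau^{(5)}$ satisfies (I) if and only if $\tau^{(6)}$ satisfies (II).
   Context: Fix $N\ge1$. $\mathbf s=(s_1,\dots,s_N)\in\mathbb Z^N$, $\mathbf t=(t_{\alpha,k})$, $\bar{\mathbf t}=(\bar t_{\alpha,k})$ with $1\le\alpha\le N$, $k\ge1$; $\mathbf t_\alpha=(t_{\alpha,k})_k$. $\xi(\mathbf t_\alpha,z)=\sum_{k\ge1}t_{\alpha,k}z^k$. $\mathbf t\pm[z^{-1}]_\gamma$ is $\mathbf t$ with $t_{\alpha,j}$ replaced by $t_{\alpha,j}\pm\delta_{\alpha\gamma}z^{-j}/j$ (same for $\bar{\mathbf t}$); $\mathbf s\pm[1]_\gamma$ is $\mathbf s$ with $s_\gamma$ replaced by $s_\gamma\pm1$. $\oint_{C_\infty}$ is the integral over a big circle around $\infty$ ($2\pi i$ times the coefficient of $z^{-1}$ of the formal integrand). Sign factors: $\epsilon_{\alpha\gamma}=1$ for $\alpha\le\gamma$ and $\epsilon_{\alpha\gamma}=-1$ for $\alpha>\gamma$; $\epsilon_{\alpha\gamma}(\mathbf s)=\exp\bigl(-i\pi\sum_{\alpha<\mu\le\gamma}s_\mu\bigr)$ for $\alpha\le\gamma$ and $\epsilon_{\alpha\gamma}(\mathbf s)=-\exp\bigl(i\pi\sum_{\gamma<\mu\le\alpha}s_\mu\bigr)$ for $\alpha>\gamma$; $\epsilon_{0N}(\mathbf s)=\exp\bigl(-i\pi\sum_{1\le\mu\le N}s_\mu\bigr)$.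 Equation (I) is the bilinear equation for the tau-function $\tau^{(5)}$ of the $N$-component Toda lattice hierarchy obtained from the Lax formalism; equation (II) is the one for the tau-function $\tau^{(6)}$ obtained by embedding the $N$-component Toda lattice into the $2N$-component universal (multi-component KP) hierarchy. *)

(* Defs.v *)
From HB Require Import structures.
From mathcomp Require Export all_boot all_order all_algebra.
From mathcomp Require Export finmap complex.
From mathcomp Require Export all_classical all_reals all_analysis.
Set Implicit Arguments.
Unset Strict Implicit.
Unset Printing Implicit Defensive.
Export Order.TTheory GRing.Theory Num.Theory.
Global Open Scope classical_set_scope.
Global Open Scope ring_scope.

(** * Formal series

    A tau function is a formal power series in the infinitely many variables
    [t_{alpha,k}], [tbar_{alpha,k}].  The integrands are series, infinite in
    both directions, in [z], whose coefficients are formal power series.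

    All the sums [\sum_(i \in A)] below range over infinite sets but are applied
    to families with finitely many nonzero terms (for the series occurring in
    the bilinear equations): in [exp (xi (t_gamma - t'_gamma, z))] the power of
    [z] is the weighted degree of the monomial, and in
    [tau (t -+ [z^-1]_gamma)] the coefficient of a given monomial and a given
    power of [z] involves finitely many coefficients of [tau]. *)

Definition monomial (V : choiceType) := {fsfun V -> nat with 0%N}.

(** [f m] is the coefficient of the monomial [m]. *)
Definition fps (K : fieldType) (V : choiceType) := monomial V -> K.

(** [f (n, m)] is the coefficient of [z ^ n] times the monomial [m]. *)
Definition zseries (K : fieldType) (V : choiceType) := int * monomial V -> K.

Section FormalSeries.
Variables (K : fieldType) (V : choiceType).
Implicit Types f g : zseries K V.

Definition zpow (k : int) : zseries K V :=
  fun p => (p == (k, [fsfun]))%:R.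

Definition zvar (v : V) : zseries K V :=
  fun p => (p == (0, [fsfun [fsfun] with v |-> 1%N]))%:R.

Definition zmul f g : zseries K V := fun p =>
  \sum_(q \in [set q : (int * monomial V) * (int * monomial V) |
                 q.1.1 + q.2.1 = p.1 /\
                 forall v, (q.1.2 v + q.2.2 v)%N = p.2 v])
    (f q.1 * g q.2).

Definition zone : zseries K V := zpow 0.

Definition zexpn f (n : nat) : zseries K V := iter n (zmul f) zone.

Definition zexp f : zseries K V := fun p =>
  \sum_(n \in [set: nat]) ((n`!)%:R^-1 * zexpn f n p).

(** Substitution of [sigma u] for each variable [u] in [f]. *)
Definition zsubst (U : choiceType) (f : fps K U) (sigma : U -> zseries K V) :
    zseries K V := fun p =>
  \sum_(b \in [set: monomial U])
    (f b * (\big[zmul/zone]_(u <- finsupp b) zexpn (sigma u) (b u)) p).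

End FormalSeries.

Arguments zpow {K V} k p.
Arguments zvar {K V} v p.
Arguments zone {K V}.

(** * Signs *)

Definition cexp (R : realType) (w : R[i]) : R[i] :=
  (expR (complex.Re w))%:C%C *
  (cos (complex.Im w) +i* sin (complex.Im w))%C.

Section Signs.
Variables (R : realType) (N : nat).
Local Notation lattice := {ffun 'I_N -> int}.
Implicit Types (s : lattice) (a b c : 'I_N).

Definition ipi : R[i] := 'i%C * (pi%:C)%C.

Definition eps a c : R[i] := if (a <= c)%N then 1 else -1.

Definition eps_s a c s : R[i] :=
  if (a <= c)%N
  then cexp (- ipi * (\sum_(mu < N | (a < mu <= c)%N) s mu)%:~R)
  else - cexp (ipi * (\sum_(mu < N | (c < mu <= a)%N) s mu)%:~R).

Definition eps0N s : R[i] := cexp (- ipi * (\sum_(mu < N) s mu)%:~R).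

Definition abs_s s : int := \sum_(mu < N) s mu.

Definition unit_at c : lattice := [ffun mu => (mu == c)%:R].

End Signs.

(** * The bilinear equations *)

Section Bilinear.
Variables (R : realType) (N : nat).
Local Notation C := (R[i]).
Local Notation lattice := {ffun 'I_N -> int}.

(** [(alpha, k)] is the index of the time [t_{alpha, k+1}]. *)
Definition times : choiceType := ('I_N * nat)%type.

(** [inl] is for the times [t], [inr] for the times [tbar]. *)
Definition ttbar : choiceType := (times + times)%type.

(** [inl] is for [(t, tbar)], [inr] for [(t', tbar')]. *)
Definition allvars : choiceType := (ttbar + ttbar)%type.

(** [tau a b s] is [tau_{a b} (s, -, -)]. *)
Definition taufun := 'I_N -> 'I_N -> lattice -> fps C ttbar.

Implicit Types (tau : taufun) (s : lattice) (a b c : 'I_N).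

(** The arguments at which a tau function is evaluated. *)
Definition args := times -> zseries C allvars.

Definition t_ : args := fun x => zvar (inl (inl x)).
Definition tbar : args := fun x => zvar (inl (inr x)).
Definition t' : args := fun x => zvar (inr (inl x)).
Definition tbar' : args := fun x => zvar (inr (inr x)).

(** [T - [z^-1]_c] and [T + [z^-1]_c]. *)
Definition shift_sub (T : args) c : args := fun x p =>
  T x p - (x.1 == c)%:R * (zpow (- (x.2.+1)%:Z) p / (x.2.+1)%:R).
Definition shift_add (T : args) c : args := fun x p =>
  T x p + (x.1 == c)%:R * (zpow (- (x.2.+1)%:Z) p / (x.2.+1)%:R).

Definition eval_tau (f : fps C ttbar) (T Tbar : args) : zseries C allvars :=
  zsubst f (fun u => match u with inl x => T x | inr x => Tbar x end).

(** [xi (T_c - T'_c, z)] *)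
Definition xi (T T' : args) c : zseries C allvars := fun p =>
  \sum_(k \in [set: nat])
    zmul (fun q => T (c, k) q - T' (c, k) q) (zpow (k.+1)%:Z) p.

Definition oint (f : zseries C allvars) : fps C allvars := fun m =>
  2%:R * ipi R * f (-1, m).

Definition delta a b : int := (a == b)%:R.

Definition integral_t tau a b c s (s' : lattice) : fps C allvars :=
  oint (zmul (zpow (s c - s' c + delta a c + delta b c - 2))
       (zmul (zexp (xi t_ t' c))
       (zmul (eval_tau (tau a c s) (shift_sub t_ c) tbar)
             (eval_tau (tau c b s') (shift_add t' c) tbar')))).

Definition integral_tbar tau a b c s (s' : lattice) : fps C allvars :=
  oint (zmul (zpow (s' c - s c - 2))
       (zmul (zexp (xi tbar tbar' c))
       (zmul (eval_tau (tau a c (s + unit_at c)) t_ (shift_sub tbar c))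
             (eval_tau (tau c b (s' - unit_at c)) t' (shift_add tbar' c))))).

Definition lhs_I tau a b s (s' : lattice) : fps C allvars := fun m =>
  \sum_(c < N) (-1) ^+ (b == c) * integral_t tau a b c s s' m.

Definition rhs_I tau a b s (s' : lattice) : fps C allvars := fun m =>
  \sum_(c < N) (-1) ^+ (a == c) * integral_tbar tau a b c s s' m.

Definition lhs_II tau a b s (s' : lattice) : fps C allvars := fun m =>
  \sum_(c < N) eps_s R a c s * (eps_s R b c s')^-1 *
    integral_t tau a b c s s' m.

Definition rhs_II tau a b s (s' : lattice) : fps C allvars := fun m =>
  - \sum_(c < N) eps R a c * eps R b c *
      eps_s R a c s * eps0N R s * (eps_s R b c s')^-1 * (eps0N R s')^-1 *
      integral_tbar tau a b c s s' m.

Definition equations_I tau :=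
  forall a b s (s' : lattice), lhs_I tau a b s s' = rhs_I tau a b s s'.

Definition equations_II tau :=
  forall a b s (s' : lattice), lhs_II tau a b s s' = rhs_II tau a b s s'.

Definition sign_related (tau5 tau6 : taufun) :=
  forall a b s m,
    tau5 a b s m =
      (-1) ^ ((abs_s s * (abs_s s - 1)) %/ 2)%Z * eps_s R a b s * tau6 a b s m.

End Bilinear.

(* Main.v *)
Require Import Defs.
From mathcomp Require Import ring.
Set Implicit Arguments.
Unset Strict Implicit.

(** All the exponentials are signs, as the [s_mu] are integers.  Substituting
    [tau5] in the [c]-th summand on the left of (I) produces, compared with (II),
    the factor [(-1)^delta_bc sigma(s) sigma(s') eps_cb(s') eps_bc(s')], where
    [sigma(s) = (-1)^(|s|(|s|-1)/2)]; since [eps_cb = - (-1)^delta_bc eps_bc],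
    it equals [- sigma(s) sigma(s')] whatever [c] is.  On the right, shifting
    [s] by [[1]_c] multiplies [sigma] by [eps_0N(s)] and [eps_ac(s)] by
    [- (-1)^delta_ac eps_ac], which gives the same factor again. *)

(** A scalar is zero or preserves the support of a family, so it leaves [\sum_(q \in A)] even when
    the support is infinite and the sum is 0 by convention. *)
Lemma zmulZl (K : fieldType) (V : choiceType) (k : K) (f g : zseries K V) :
  zmul (fun p => k * f p) g = fun p => k * zmul f g p.
Proof.
apply/funext => p; rewrite /zmul mulr_fsumr.
by apply: eq_fsbigr => q _; rewrite mulrA.
Qed.

Lemma zmulZr (K : fieldType) (V : choiceType) (k : K) (f g : zseries K V) :
  zmul f (fun p => k * g p) = fun p => k * zmul f g p.
Proof.
apply/funext => p; rewrite /zmul mulr_fsumr.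
by apply: eq_fsbigr => q _; rewrite mulrCA.
Qed.

Lemma zsubstZ (K : fieldType) (V U : choiceType) (k : K) (f g : fps K U)
    (sigma : U -> zseries K V) :
  (forall m, f m = k * g m) ->
  zsubst f sigma = fun p => k * zsubst g sigma p.
Proof.
move=> fg; apply/funext => p; rewrite /zsubst mulr_fsumr.
by apply: eq_fsbigr => b _; rewrite fg mulrA.
Qed.

Lemma cexp_ipi_int (R : realType) (n : int) :
  cexp (ipi R * n%:~R) = (-1) ^ n.
Proof.
have -> : ipi R * n%:~R = (0 +i* (pi * n%:~R))%C.
  have -> : n%:~R = (n%:~R +i* 0)%C :> R[i].
    by rewrite -[RHS]/(_%:C%C) rmorph_int.
  by apply/eqP; rewrite eq_complex /=; apply/andP; split; apply/eqP; ring.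
rewrite /cexp /= expR0 mul1r expN1r.
have [cosE sinE] : cos (pi * n%:~R) = (-1) ^+ `|n|%N :> R /\ sin (pi * n%:~R) = 0 :> R.
  (* Adding $\pi$ negates both functions; negative integers then follow by parity of cos and oddness
     of sin. *)
  have natE (k : nat) : cos (pi * k%:R) = (-1) ^+ k :> R /\ sin (pi * k%:R) = 0 :> R.
    elim: k => [|k [IHc IHs]]; first by rewrite mulr0 cos0 sin0.
    by rewrite -natr1 mulrDr mulr1 cosDpi sinDpi exprS IHc IHs mulN1r oppr0.
  case: n => k; first exact: natE.
  have [ck sk] := natE k.+1.
  by rewrite NegzE mulrNz mulrN cosN sinN ck sk oppr0 abszN.
by rewrite cosE sinE -[LHS]/(((-1) ^+ `|n|%N : R)%:C%C) rmorphXn /= rmorphN1.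
Qed.

Lemma signzN (F : numFieldType) (n : int) : (-1) ^ (- n) = (-1) ^ n :> F.
Proof. by rewrite !expN1r abszN. Qed.

Lemma signzMM (F : numFieldType) (n : int) : (-1) ^ n * (-1) ^ n = 1 :> F.
Proof. by rewrite expN1r -expr2 sqrr_sign. Qed.

Lemma signzD (F : numFieldType) (m n : int) :
  (-1) ^ (m + n) = (-1) ^ m * (-1) ^ n :> F.
Proof. by rewrite expfzDr // oppr_eq0 oner_eq0. Qed.

Section Signs.
Variables (R : realType) (N : nat).
Implicit Types (s : {ffun 'I_N -> int}) (a b c : 'I_N).

Definition toda_sign s : R[i] := (-1) ^ ((abs_s s * (abs_s s - 1)) %/ 2)%Z.

Lemma eps_sE a c s : eps_s R a c s =
  if (a <= c)%N then (-1) ^ (\sum_(mu < N | (a < mu <= c)%N) s mu)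
  else - (-1) ^ (\sum_(mu < N | (c < mu <= a)%N) s mu).
Proof. by rewrite /eps_s mulNr -mulrN -mulrNz !cexp_ipi_int signzN. Qed.

Lemma eps0NE s : eps0N R s = (-1) ^ abs_s s.
Proof. by rewrite /eps0N mulNr -mulrN -mulrNz cexp_ipi_int signzN. Qed.

Lemma eps_s_inv a c s : (eps_s R a c s)^-1 = eps_s R a c s.
Proof.
by rewrite eps_sE; case: ifP => _; rewrite ?invrN invr_expz signzN.
Qed.

(** Off the diagonal both sums run over the same interval and exactly one of the two signs has the
    extra minus; on it, $-(-1)^1=1$. *)
Lemma eps_s_swap b c s :
  eps_s R c b s = - (-1) ^+ (b == c) * eps_s R b c s.
Proof.
rewrite !eps_sE -(inj_eq val_inj) /=; case: ltngtP => [_|_|->] /=.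
- by rewrite expr0 mulN1r opprK.
- by rewrite expr0 mulN1r.
- by rewrite expr1 opprK mul1r.
Qed.

(** [P] serves both the intervals in [eps_s] and the full range in [abs_s]. *)
Lemma sum_add_unit (P : pred 'I_N) c s :
  \sum_(mu | P mu) (s + unit_at c) mu = \sum_(mu | P mu) s mu + (P c)%:R.
Proof.
under eq_bigr do rewrite !ffunE.
rewrite big_split /=; congr (_ + _).
case Pc: (P c); last first.
  by apply: big1 => mu Pmu; case: eqP Pmu => // ->; rewrite Pc.
by rewrite (bigD1 c) //= eqxx big1 ?addr0 // => mu /andP[_ /negPf->].
Qed.

(** The interval $a<\mu\le c$ contains $c$ when $a<c$, which flips the sign; $c<\mu\le a$ never
    contains $c$. *)
Lemma eps_s_add_unit a c s :
  eps_s R a c (s + unit_at c) = - (-1) ^+ (a == c) * eps R a c * eps_s R a c s.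
Proof.
rewrite !eps_sE !sum_add_unit !signzD /eps -(inj_eq val_inj) /= ltnn leqnn andbT.
case: ltngtP => _ /=; rewrite ?expr0z ?expr1z ?expr0 ?expr1; ring.
Qed.

Lemma eps_s_sub_unit b c s :
  eps_s R c b (s - unit_at c) = eps R b c * eps_s R b c s.
Proof.
(* The upward shift is read at $\mathbf s-[1]_c$; the swap cancels $-(-1)^{\delta_{bc}}$, and
   $\epsilon_{bc}^2=1$. *)
rewrite -[s in RHS](subrK (unit_at c)) eps_s_add_unit eps_s_swap /eps.
by case: ifP => _; rewrite ?mulr1 ?mul1r // mulrN1 mulNr mulN1r opprK.
Qed.

Lemma abs_s_add_unit c s : abs_s (s + unit_at c) = abs_s s + 1.
Proof. exact: sum_add_unit. Qed.

(* [(n + 1) n / 2 = n (n - 1) / 2 + n] *)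
Lemma toda_sign_add_unit c s :
  toda_sign (s + unit_at c) = (-1) ^ abs_s s * toda_sign s.
Proof.
rewrite /toda_sign abs_s_add_unit -signzD; congr (_ ^ _).
by rewrite -divzMDl //; congr (_ %/ _)%Z; ring.
Qed.

(** The exponent is now $|\mathbf s|-1$, whence the minus sign. *)
Lemma toda_sign_sub_unit c s :
  toda_sign (s - unit_at c) = - (-1) ^ abs_s s * toda_sign s.
Proof.
rewrite -[s in RHS](subrK (unit_at c)) toda_sign_add_unit abs_s_add_unit signzD.
by rewrite expr1z mulrN1 opprK mulrA signzMM mul1r.
Qed.

Lemma toda_sign_or s : toda_sign s = 1 \/ toda_sign s = -1.
Proof.
rewrite /toda_sign expN1r -signr_odd.
by case: odd; [right; rewrite expr1 | left; rewrite expr0].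
Qed.

Variables tau5 tau6 : taufun R N.

(** The signs involve neither the times nor $z$, so they pass through substitution, products and the
    residue. *)
Lemma integral_t_sign (tau56 : sign_related tau5 tau6) a b c s s' m :
  integral_t tau5 a b c s s' m =
  (toda_sign s * eps_s R a c s) * (toda_sign s' * eps_s R c b s') *
  integral_t tau6 a b c s s' m.
Proof.
rewrite /integral_t /eval_tau /oint.
rewrite !(zsubstZ _ (tau56 _ _ _)) !(zmulZl, zmulZr) /toda_sign; ring.
Qed.

Lemma integral_tbar_sign (tau56 : sign_related tau5 tau6) a b c s s' m :
  integral_tbar tau5 a b c s s' m =
  (toda_sign (s + unit_at c) * eps_s R a c (s + unit_at c)) *
  (toda_sign (s' - unit_at c) * eps_s R c b (s' - unit_at c)) *
  integral_tbar tau6 a b c s s' m.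
Proof.
rewrite /integral_tbar /eval_tau /oint.
rewrite !(zsubstZ _ (tau56 _ _ _)) !(zmulZl, zmulZr) /toda_sign; ring.
Qed.

Lemma lhs_I_sign (tau56 : sign_related tau5 tau6) a b s s' m :
  lhs_I tau5 a b s s' m =
  - (toda_sign s * toda_sign s') * lhs_II tau6 a b s s' m.
Proof.
rewrite /lhs_I /lhs_II mulr_sumr; apply: eq_bigr => c _.
rewrite (integral_t_sign tau56) eps_s_inv (eps_s_swap b).
(* One factor $(-1)^{\delta_{bc}}$ comes from (I), the other from the swap; their square is 1. *)
transitivity (((-1) ^+ (b == c)) ^+ 2 * (- (toda_sign s * toda_sign s') *
  (eps_s R a c s * eps_s R b c s' * integral_t tau6 a b c s s' m))).
  by ring.
by rewrite sqrr_sign mul1r.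
Qed.

Lemma rhs_I_sign (tau56 : sign_related tau5 tau6) a b s s' m :
  rhs_I tau5 a b s s' m =
  - (toda_sign s * toda_sign s') * rhs_II tau6 a b s s' m.
Proof.
rewrite /rhs_I /rhs_II mulrNN mulr_sumr; apply: eq_bigr => c _.
rewrite (integral_tbar_sign tau56) eps_s_inv eps_s_add_unit.
rewrite eps_s_sub_unit toda_sign_add_unit toda_sign_sub_unit !eps0NE.
rewrite invr_expz signzN.
(* Here the second factor $(-1)^{\delta_{ac}}$ comes from shifting $\epsilon_{ac}(\mathbf s)$. *)
transitivity (((-1) ^+ (a == c)) ^+ 2 * (toda_sign s * toda_sign s' *
  (eps R a c * eps R b c * eps_s R a c s * (-1) ^ abs_s s * eps_s R b c s' *
   (-1) ^ abs_s s' * integral_tbar tau6 a b c s s' m))).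
  by ring.
by rewrite sqrr_sign mul1r.
Qed.

End Signs.

Theorem proposition6p2 (R : realType) (N : nat) (hN : (0 < N)%N) :
  (forall (a b : 'I_N) (s s' : {ffun 'I_N -> int}),
     exists c : R[i], (c = 1 \/ c = -1) /\
       forall tau5 tau6 : taufun R N, sign_related tau5 tau6 ->
         forall m : monomial (allvars N),
           lhs_I tau5 a b s s' m = c * lhs_II tau6 a b s s' m /\
           rhs_I tau5 a b s s' m = c * rhs_II tau6 a b s s' m) /\
  (forall tau5 tau6 : taufun R N, sign_related tau5 tau6 ->
     (equations_I tau5 <-> equations_II tau6)).
Proof.
have sign_or (s s' : {ffun 'I_N -> int}) :
    - (toda_sign R s * toda_sign R s') = 1 \/
    - (toda_sign R s * toda_sign R s') = -1.
  by case: (toda_sign_or R s) => ->; case: (toda_sign_or R s') => ->;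
    rewrite !(mulr1, mulrN1, opprK); auto.
split=> [a b s s'|tau5 tau6 tau56].
  exists (- (toda_sign R s * toda_sign R s')); split; first exact: sign_or.
  by move=> tau5 tau6 tau56 m; rewrite (lhs_I_sign tau56) (rhs_I_sign tau56).
split=> eqs a b s s'; apply/funext => m; last first.
  by rewrite (lhs_I_sign tau56) (rhs_I_sign tau56) eqs.
have := congr1 (fun f => f m) (eqs a b s s').
rewrite (lhs_I_sign tau56) (rhs_I_sign tau56).
(* The common constant is $\pm1$, hence can be cancelled. *)
by apply: mulfI; case: (sign_or s s') => ->; rewrite ?oppr_eq0 oner_eq0.
Qed.
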